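(* For every real number $x$ there exist real numbers $u, v$ such that $x = u + v$ and both $u$ and $v$ have the property that all their nearest integer continued fraction partial quotients $a_i$ with $i \ge 1$ satisfy $|a_i| \le 5$ (no condition is imposed on $a_0$).
   Context: The nearest integer continued fraction (NICF) expansion $[a_0; a_1, a_2, \ldots]$ of a real number $x$ is obtained by setting $x_0 = x$ and iterating $a_i = \lfloor x_i \rceil$ (the integer nearest to $x_i$) and $x_{i+1} = 1/(x_i - a_i)$ as long as $x_i \neq a_i$; then $x = a_0 + \cfrac{1}{a_1 + \cfrac{1}{a_2 + \cdots}}$. The integers $a_i$ are the partial quotients. The sequences arising in this way are exactly those with $a_i \in \mathbb{Z}\setminus\{-1,0,1\}$ for $i \ge 1$, with $a_{i+1} \ge 2$ whenever $a_i = 2$ and $a_{i+1} \le -2$ whenever $a_i = -2$. *)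

(* Defs.v *)
From Stdlib Require Import Reals ZArith Lra.
Open Scope R_scope.

(* Ties are rounded up: 1/2 |-> 1, -1/2 |-> 0. *)
Definition nearest_int (x : R) : Z := Int_part (x + 1 / 2).

Lemma nearest_int_spec (x : R) : - (1 / 2) <= x - IZR (nearest_int x) < 1 / 2.
Proof. unfold nearest_int; destruct (base_Int_part (x + 1 / 2)); lra. Qed.

(* The complete quotient x_i; None when the expansion has stopped earlier,
   that is, when x_j is an integer for some j < i. *)
Fixpoint nicf_complete (x : R) (i : nat) : option R :=
  match i with
  | O => Some x
  | S j =>
      match nicf_complete x j with
      | Some y =>
          if Req_dec_T y (IZR (nearest_int y)) then None
          else Some (1 / (y - IZR (nearest_int y)))
      | None => None
      end
  end.

Definition nicf_quotient (x : R) (i : nat) : option Z :=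
  option_map nearest_int (nicf_complete x i).

Definition nicf_quotients_bounded (N : Z) (x : R) : Prop :=
  forall (i : nat) (a : Z),
    (1 <= i)%nat -> nicf_quotient x i = Some a -> (Z.abs a <= N)%Z.

(* Main.v *)
(** Let [m] satisfy [m (5 - m) = 1] and let [E] be the set of [1 / y] where [y]
    lies in [[2 + m, 5 - m]] and is of the form [a + t] or [a + 1 - t] with
    [a] in [{2, 3, 4}] and [t] again in [E].  Such a [1 / y] has an NICF with
    partial quotients at most 5 in absolute value, in which 5 is always followed
    by a negative quotient and -5 by a positive one.  Dropping the words in which
    5 is followed by a positive quotient is essential: on the set of all numbers
    with quotients at most 5, the bridge they form is shorter than the
    neighbouring gap.  On [E], the construction as a Cantor set by successive
    binary splittings removes only gaps that are no longer than either adjacent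
    bridge and no longer than the previously removed gap, so the argument of Hall
    and Newhouse shows that [E + E], [E - E] and [- E - E] are intervals.
    Modulo 1 these cover the line. *)

Require Import Defs.
From Stdlib Require Import Reals ZArith Lra Lia.
Open Scope R_scope.

(** * Sums of two points, each a limit of nodes in a binary tree of intervals *)

Section IntervalTree.

Variables (N : Type) (valid : N -> Prop) (lo hi gap : N -> R).
Variables (lower upper : N -> N) (rank : N -> nat).

Definition split_into (n a b : N) : Prop :=
  lo a = lo n /\ lo b = hi a + gap n /\ hi b = hi n.

Hypothesis valid_lower : forall n, valid n -> valid (lower n).
Hypothesis valid_upper : forall n, valid n -> valid (upper n).
Hypothesis split : forall n, valid n ->
  split_into n (lower n) (upper n) \/ split_into n (upper n) (lower n).
Hypothesis gap_pos : forall n, valid n -> 0 < gap n.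
Hypothesis gap_le_lower :
  forall n, valid n -> gap n <= hi (lower n) - lo (lower n).
Hypothesis gap_le_upper :
  forall n, valid n -> gap n <= hi (upper n) - lo (upper n).
Hypothesis gap_lower : forall n, valid n -> gap (lower n) <= gap n.
Hypothesis gap_upper : forall n, valid n -> gap (upper n) <= gap n.
Hypothesis rank_lower : forall n, (rank n < rank (lower n))%nat.
Hypothesis rank_upper : forall n, (rank n < rank (upper n))%nat.
Hypothesis gap_bounded_below : forall r : nat, exists eps,
  0 < eps /\ forall n, valid n -> (rank n <= r)%nat -> eps <= gap n.
Hypothesis length_small : forall eps, 0 < eps -> exists r : nat,
  forall n, valid n -> (r <= rank n)%nat -> hi n - lo n < eps.

(** The last two clauses are the Hall-Newhouse condition: removing the gap of one node does not
    change its sum with the interval of the other. *)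
Definition admissible (s : R) (p : N * N) : Prop :=
  valid (fst p) /\ valid (snd p) /\
  lo (fst p) + lo (snd p) <= s <= hi (fst p) + hi (snd p) /\
  gap (fst p) <= hi (snd p) - lo (snd p) /\
  gap (snd p) <= hi (fst p) - lo (fst p).

Definition descend (s : R) (n k : N) : N :=
  if Rle_dec (lo (lower n) + lo k) s then
    if Rle_dec s (hi (lower n) + hi k) then lower n else upper n
  else upper n.

(* Splitting the node with the larger gap is what preserves admissibility. *)
Definition step (s : R) (p : N * N) : N * N :=
  if Rle_dec (gap (snd p)) (gap (fst p))
  then (descend s (fst p) (snd p), snd p)
  else (fst p, descend s (snd p) (fst p)).

Definition inside (a n : N) : Prop := lo n <= lo a /\ hi a <= hi n.

(** As [gap n] is at most the length of [k], the sums of [k] with the two children leave no hole.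
    Both gap conditions survive: the child's gap is at most [gap n], and [gap k] is at most [gap n],
    hence at most the length of either child. *)
Lemma descend_spec (s : R) (n k : N) :
  admissible s (n, k) -> gap k <= gap n ->
  admissible s (descend s n k, k) /\ inside (descend s n k) n /\
  (rank n < rank (descend s n k))%nat.
Proof.
  intros (Vn & Vk & Hs & H1 & H2) Hg; simpl in *.
  pose proof (valid_lower n Vn); pose proof (valid_upper n Vn).
  pose proof (gap_pos n Vn).
  pose proof (gap_le_lower n Vn); pose proof (gap_le_upper n Vn).
  pose proof (gap_lower n Vn); pose proof (gap_upper n Vn).
  pose proof (rank_lower n); pose proof (rank_upper n).
  unfold descend, admissible, inside; simpl.
  destruct (split n Vn) as [(E1 & E2 & E3) | (E1 & E2 & E3)];
    destruct (Rle_dec _ _); try destruct (Rle_dec _ _);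
    repeat split; auto; lra.
Qed.

Lemma admissible_swap (s : R) (n k : N) :
  admissible s (n, k) -> admissible s (k, n).
Proof. unfold admissible; simpl; intuition lra. Qed.

Lemma step_spec (s : R) (p : N * N) :
  admissible s p ->
  admissible s (step s p) /\
  inside (fst (step s p)) (fst p) /\ inside (snd (step s p)) (snd p) /\
  (rank (fst p) + rank (snd p) <
     rank (fst (step s p)) + rank (snd (step s p)))%nat.
Proof.
  destruct p as [n k]; intros A; unfold step; simpl.
  destruct (Rle_dec _ _) as [g | g]; simpl.
  - destruct (descend_spec s n k A g) as (H1 & H2 & H3).
    repeat split; try apply H1; try apply H2; try lra; lia.
  - apply admissible_swap in A.
    destruct (descend_spec s k n A) as (H1 & H2 & H3); [lra|].
    apply admissible_swap in H1.
    repeat split; try apply H1; try apply H2; try lra; lia.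
Qed.

Fixpoint descent (s : R) (p : N * N) (i : nat) : N * N :=
  match i with O => p | S j => step s (descent s p j) end.

Lemma descent_admissible (s : R) (p : N * N) (i : nat) :
  admissible s p -> admissible s (descent s p i).
Proof. intros A; induction i; simpl; [exact A | now apply step_spec]. Qed.

Lemma descent_rank (s : R) (p : N * N) (i : nat) :
  admissible s p ->
  (i <= rank (fst (descent s p i)) + rank (snd (descent s p i)))%nat.
Proof.
  intros A; induction i; simpl; [lia|].
  destruct (step_spec s _ (descent_admissible s p i A)) as (_ & _ & _ & H).
  lia.
Qed.

Lemma descent_inside (s : R) (p : N * N) (i j : nat) :
  admissible s p ->
  inside (fst (descent s p (i + j))) (fst (descent s p j)) /\
  inside (snd (descent s p (i + j))) (snd (descent s p j)).
Proof.
  intros A; induction i; simpl.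
  - unfold inside; lra.
  - destruct (step_spec s _ (descent_admissible s p (i + j) A))
      as (_ & H1 & H2 & _).
    unfold inside in *; lra.
Qed.

Lemma nested_intervals (a b : nat -> R) :
  (forall i j, a i <= b j) -> exists u, forall i, a i <= u <= b i.
Proof.
  intros H.
  destruct (completeness (fun x => exists i, x = a i)) as [u [Hu1 Hu2]].
  - exists (b O); intros x [i ->]; apply H.
  - exists (a O), O; reflexivity.
  - exists u; intros i; split.
    + apply Hu1; now exists i.
    + apply Hu2; intros x [j ->]; apply H.
Qed.

Lemma descent_limit (s : R) (p : N * N) :
  admissible s p ->
  exists u, forall i,
    lo (fst (descent s p i)) <= u <= hi (fst (descent s p i)) /\
    lo (snd (descent s p i)) <= s - u <= hi (snd (descent s p i)).
Proof.
  intros A.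
  (* At each stage the conditions on [u] and on [s - u] combine into a single interval for [u]. *)
  destruct (nested_intervals
    (fun i => Rmax (lo (fst (descent s p i))) (s - hi (snd (descent s p i))))
    (fun i => Rmin (hi (fst (descent s p i))) (s - lo (snd (descent s p i)))))
    as [u Hu].
  - intros i j.
    destruct (descent_inside s p i j A) as [[P1 P2] [P3 P4]].
    destruct (descent_inside s p j i A) as [[Q1 Q2] [Q3 Q4]].
    (* Stage [i + j] lies inside stages [i] and [j]; there admissibility and positive gaps make both
       intervals nonempty and put [s] in their sum. *)
    rewrite (Nat.add_comm j i) in *.
    destruct (descent_admissible s p (i + j) A) as (V1 & V2 & Hs & G1 & G2).
    pose proof (gap_pos _ V1); pose proof (gap_pos _ V2).
    apply Rmax_lub; apply Rmin_glb; lra.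
  - exists u; intros i; specialize (Hu i); simpl in Hu.
    pose proof (Rmax_l (lo (fst (descent s p i))) (s - hi (snd (descent s p i)))).
    pose proof (Rmax_r (lo (fst (descent s p i))) (s - hi (snd (descent s p i)))).
    pose proof (Rmin_l (hi (fst (descent s p i))) (s - lo (snd (descent s p i)))).
    pose proof (Rmin_r (hi (fst (descent s p i))) (s - lo (snd (descent s p i)))).
    lra.
Qed.

(* A node of bounded rank has a large gap, hence, by admissibility, a long
   partner, which therefore has bounded rank too. *)
Lemma admissible_rank (r : nat) : exists k, forall s p, admissible s p ->
  (k <= rank (fst p) + rank (snd p))%nat ->
  (r < rank (fst p))%nat /\ (r < rank (snd p))%nat.
Proof.
  destruct (gap_bounded_below r) as (eps & Heps & H1).
  destruct (length_small eps Heps) as (r' & H2).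
  exists (r + r')%nat; intros s [n k] (V1 & V2 & _ & G1 & G2) Hk; simpl in *.
  split.
  - destruct (le_lt_dec (rank n) r) as [L|L]; [|lia].
    pose proof (H1 n V1 L).
    assert (hi k - lo k < eps) by (apply H2; [easy | lia]); lra.
  - destruct (le_lt_dec (rank k) r) as [L|L]; [|lia].
    pose proof (H1 k V2 L).
    assert (hi n - lo n < eps) by (apply H2; [easy | lia]); lra.
Qed.

(** The nodes for different [r] need not lie on one branch: each partial quotient will be read off a
    single deep node. *)
Definition tree_limit (u : R) : Prop :=
  forall r : nat, exists n, valid n /\ (r < rank n)%nat /\ lo n <= u <= hi n.

Theorem sum_of_tree_limits (s : R) (n k : N) :
  admissible s (n, k) -> exists u, tree_limit u /\ tree_limit (s - u).
Proof.
  intros A; destruct (descent_limit s (n, k) A) as [u Hu].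
  exists u; split; intros r; destruct (admissible_rank r) as [i Hi];
    pose proof (descent_admissible s (n, k) i A) as Ai;
    destruct (Hi s _ Ai (descent_rank s (n, k) i A)) as [R1 R2];
    destruct (Hu i) as [U1 U2]; destruct Ai as (V1 & V2 & _).
  - now exists (fst (descent s (n, k) i)).
  - now exists (snd (descent s (n, k) i)).
Qed.

End IntervalTree.

(** * The extreme points of the Cantor set *)

(* [1 / y] runs over [[m, M]] when [y] runs over [[2 + m, 5 - m]]. *)
Definition m : R := (5 - sqrt 21) / 2.
Definition M : R := / (2 + m).

Lemma m_eq : m * (5 - m) = 1.
Proof.
  unfold m; pose proof (sqrt_sqrt 21 ltac:(lra)); nra.
Qed.

Lemma m_bounds : 2087 / 10000 < m < 2088 / 10000.
Proof.
  unfold m; pose proof (sqrt_sqrt 21 ltac:(lra)).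
  pose proof (sqrt_pos 21); nra.
Qed.

(** This fixed-point identity makes the tree self-similar: reciprocals of the full interval fill
    exactly [[m, M]], so both pieces of a block are again images of the full interval. *)
Lemma m_inv : / (5 - m) = m.
Proof.
  pose proof m_eq; pose proof m_bounds.
  apply Rmult_eq_reg_r with (5 - m); [|lra].
  rewrite Rinv_l; lra.
Qed.

Lemma M_eq : M * (2 + m) = 1.
Proof. unfold M; pose proof m_bounds; apply Rinv_l; lra. Qed.

Lemma M_bounds : 4527 / 10000 < M < 4528 / 10000.
Proof. pose proof M_eq; pose proof m_bounds; nra. Qed.

(** * The tree of images under Möbius maps *)

(* The intervals met in the splitting: [[2 + m, 5 - m]], [[3 + m, 5 - m]] and
   [[a + m, a + 1 - m]].  Each [[p1, p4]] splits into [[p1, p2]] and [[p3, p4]]. *)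
Inductive shape := Full | Tail | Block (a : Z).

Definition p1 (t : shape) : R :=
  match t with Full => 2 + m | Tail => 3 + m | Block a => IZR a + m end.
Definition p2 (t : shape) : R :=
  match t with Full => 3 - m | Tail => 4 - m | Block a => IZR a + M end.
Definition p3 (t : shape) : R :=
  match t with Full => 3 + m | Tail => 4 + m | Block a => IZR a + 1 - M end.
Definition p4 (t : shape) : R :=
  match t with Full => 5 - m | Tail => 5 - m | Block a => IZR a + 1 - m end.

(* The image of the interval of shape [ns] under [y |-> nc + ne / (y + nd)];
   [nl] counts the NICF steps already fixed.  Here [nd] is the ratio of the
   denominators of the last two convergents, up to sign. *)
Record node := Node { nc : R; ne : R; nd : R; ns : shape; nl : nat }.

Definition mob (n : node) (y : R) : R := nc n + ne n / (y + nd n).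

(* On a block, [y = a + 1 / y'] on the lower half and [y = a + 1 - 1 / y'] on the
   upper half, with [y'] running over the full interval. *)
Definition lower (n : node) : node :=
  match ns n with
  | Full => Node (nc n) (ne n) (nd n) (Block 2) (nl n)
  | Tail => Node (nc n) (ne n) (nd n) (Block 3) (nl n)
  | Block a => let A := IZR a + nd n in
      Node (nc n + ne n / A) (- ne n / (A * A)) (/ A) Full (S (nl n))
  end.

Definition upper (n : node) : node :=
  match ns n with
  | Full => Node (nc n) (ne n) (nd n) Tail (nl n)
  | Tail => Node (nc n) (ne n) (nd n) (Block 4) (nl n)
  | Block a => let A := IZR a + 1 + nd n in
      Node (nc n + ne n / A) (ne n / (A * A)) (- / A) Full (S (nl n))
  end.

(** The sign of [ne n] decides whether [mob n] preserves or reverses order, hence the minimum and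
    maximum. *)
Definition lo (n : node) : R := Rmin (mob n (p1 (ns n))) (mob n (p4 (ns n))).
Definition hi (n : node) : R := Rmax (mob n (p1 (ns n))) (mob n (p4 (ns n))).
Definition wid (d x y : R) : R := / (x + d) - / (y + d).
Definition gap (n : node) : R :=
  Rabs (ne n) * wid (nd n) (p2 (ns n)) (p3 (ns n)).
(** Between two NICF steps a branch passes through at most the three stages full, tail, block, in
    this order. *)
Definition rank (n : node) : nat :=
  3 * nl n + match ns n with Full => 0 | Tail => 1 | Block _ => 2 end.

(* The range of [nd] is stable under [d |-> 1 / (a + d)] and
   [d |-> - 1 / (a + 1 + d)] for [2 <= a <= 4]. *)
Definition geometric (n : node) : Prop :=
  ne n <> 0 /\ - (2 / 5) <= nd n <= 5 / 8 /\
  (forall a, ns n = Block a -> (2 <= a <= 4)%Z) /\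
  / 36 ^ nl n <= Rabs (ne n) <= / 2 ^ nl n.

(** The sign stays open because the upper half [a + 1 - 1 / y'] of a block turns the next complete
    quotient from [y'] into [- y']. *)
Definition arithmetic (n : node) : Prop :=
  forall y, p1 (ns n) <= y <= p4 (ns n) ->
    (nicf_complete (mob n y) (S (nl n)) = Some y \/
     nicf_complete (mob n y) (S (nl n)) = Some (- y)) /\
    forall i a, (1 <= i <= nl n)%nat ->
      nicf_quotient (mob n y) i = Some a -> (Z.abs a <= 5)%Z.

Definition valid (n : node) : Prop := geometric n /\ arithmetic n.

(** * Gaps compared with the adjacent bridges *)

Lemma block_range (n : node) (a : Z) :
  geometric n -> ns n = Block a -> 2 <= IZR a <= 4.
Proof.
  intros (_ & _ & H & _) E; destruct (H a E) as [H1 H2].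
  split; apply IZR_le; assumption.
Qed.

(** The bound 9/100 comes from the block gap [1 - 2 * M]; the other gaps are [2 * m]. The bound 8/5
    is [2 - 2 / 5]. *)
Lemma breakpoints (n : node) : geometric n ->
  8 / 5 < p1 (ns n) + nd n /\ p1 (ns n) < p2 (ns n) /\ p2 (ns n) < p3 (ns n) /\
  p3 (ns n) < p4 (ns n) /\ p4 (ns n) + nd n < 6 /\
  9 / 100 < p3 (ns n) - p2 (ns n) <= p2 (ns n) - p1 (ns n).
Proof.
  intros G; pose proof m_bounds; pose proof M_bounds.
  pose proof (block_range n) as Hb.
  pose proof G as (_ & Hd & _).
  destruct (ns n) as [| |a]; simpl;
    try specialize (Hb a G eq_refl); lra.
Qed.

Lemma wid_frac (d x y : R) : 0 < x + d -> 0 < y + d ->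
  wid d x y = (y - x) / ((x + d) * (y + d)).
Proof. intros; unfold wid; field; lra. Qed.

Lemma frac_le (x y z w : R) : 0 < y -> 0 < w -> x * w <= z * y -> x / y <= z / w.
Proof.
  intros Hy Hw H; apply Rmult_le_reg_r with (y * w).
  - now apply Rmult_lt_0_compat.
  - replace (x / y * (y * w)) with (x * w) by (field; lra).
    replace (z / w * (y * w)) with (z * y) by (field; lra).
    exact H.
Qed.

Lemma wid_le (d x y x' y' : R) :
  0 < x + d -> 0 < y + d -> 0 < x' + d -> 0 < y' + d ->
  (y - x) * ((x' + d) * (y' + d)) <= (y' - x') * ((x + d) * (y + d)) ->
  wid d x y <= wid d x' y'.
Proof.
  intros; rewrite !wid_frac by assumption.
  apply frac_le; [apply Rmult_lt_0_compat .. |]; assumption.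
Qed.

Lemma wid_pos (d x y : R) : 0 < x + d -> x < y -> 0 < wid d x y.
Proof.
  intros H1 H2; unfold wid.
  assert (/ (y + d) < / (x + d)); [|lra].
  apply Rinv_lt_contravar; [apply Rmult_lt_0_compat|]; lra.
Qed.

(** The map [1 / (y + d)] stretches more the closer [y] is to the pole; the lower piece is closer
    than the gap and is at least as long before mapping. *)
Lemma wid_gap_lower (n : node) : geometric n ->
  wid (nd n) (p2 (ns n)) (p3 (ns n)) <= wid (nd n) (p1 (ns n)) (p2 (ns n)).
Proof.
  intros G; pose proof (breakpoints n G).
  apply wid_le; try lra.
  apply Rmult_le_compat; try lra; [apply Rmult_le_pos; lra|].
  rewrite (Rmult_comm (p1 (ns n) + nd n)).
  apply Rmult_le_compat_l; lra.
Qed.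

(** The upper piece is farther from the pole, so lengths before mapping do not suffice. Cancelling
    the common factor [p3 + d] leaves the inequality [L], tightest for [Tail] with [d] near -2/5. *)
Lemma wid_gap_upper (n : node) : geometric n ->
  wid (nd n) (p2 (ns n)) (p3 (ns n)) <= wid (nd n) (p3 (ns n)) (p4 (ns n)).
Proof.
  intros G; pose proof (breakpoints n G) as B.
  apply wid_le; try lra.
  assert (L : (p3 (ns n) - p2 (ns n)) * (p4 (ns n) + nd n) <=
              (p4 (ns n) - p3 (ns n)) * (p2 (ns n) + nd n)).
  { clear B; pose proof m_bounds; pose proof M_bounds.
    pose proof (block_range n) as Hb.
    pose proof G as (_ & Hd & _).
    destruct (ns n) as [| |a]; simpl; try specialize (Hb a G eq_refl); nra. }
  apply Rmult_le_compat_r with (r := p3 (ns n) + nd n) in L; lra.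
Qed.

(** * Endpoints of the children *)

Lemma mob_sub (n : node) (x y : R) :
  mob n x - mob n y = ne n * wid (nd n) x y.
Proof. unfold mob, wid, Rdiv; ring. Qed.

Lemma length_eq (n : node) : geometric n ->
  hi n - lo n = Rabs (ne n) * wid (nd n) (p1 (ns n)) (p4 (ns n)).
Proof.
  intros G; pose proof (breakpoints n G) as B.
  pose proof (wid_pos (nd n) (p1 (ns n)) (p4 (ns n))) as W.
  rewrite <- (Rabs_pos_eq (wid _ _ _)), <- Rabs_mult, <- mob_sub
    by (apply Rlt_le, W; lra).
  unfold hi, lo, Rmax, Rmin, Rabs.
  destruct (Rle_dec _ _), (Rcase_abs _); lra.
Qed.

Lemma mob_lower (n : node) (a : Z) (z : R) :
  geometric n -> ns n = Block a -> 2 < z ->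
  mob (lower n) z = mob n (IZR a + / z).
Proof.
  intros G E Hz; pose proof (block_range n a G E).
  pose proof G as (_ & Hd & _).
  unfold lower, mob; rewrite E; simpl; field.
  assert (0 < (IZR a + nd n) * z) by (apply Rmult_lt_0_compat; lra).
  repeat split; lra.
Qed.

Lemma mob_upper (n : node) (a : Z) (z : R) :
  geometric n -> ns n = Block a -> 2 < z ->
  mob (upper n) z = mob n (IZR a + 1 - / z).
Proof.
  intros G E Hz; pose proof (block_range n a G E).
  pose proof G as (_ & Hd & _).
  unfold upper, mob; rewrite E; simpl; field.
  assert (2 * 2 < (IZR a + 1 + nd n) * z) by (apply Rmult_le_0_lt_compat; lra).
  repeat split; lra.
Qed.

Lemma lower_ends (n : node) : geometric n ->
  lo (lower n) = Rmin (mob n (p1 (ns n))) (mob n (p2 (ns n))) /\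
  hi (lower n) = Rmax (mob n (p1 (ns n))) (mob n (p2 (ns n))).
Proof.
  intros G; pose proof m_bounds; unfold lo, hi.
  destruct (ns n) as [| |a] eqn:E.
  - unfold lower; rewrite E; simpl.
    replace (2 + 1 - m) with (3 - m) by lra; split; reflexivity.
  - unfold lower; rewrite E; simpl.
    replace (3 + 1 - m) with (4 - m) by lra; split; reflexivity.
  - assert (S : ns (lower n) = Full) by (unfold lower; now rewrite E).
    rewrite S; simpl; rewrite !(mob_lower n a) by (auto; lra).
    (* Taking reciprocals swaps the ends: [5 - m] goes to [a + m] and [2 + m] to [a + M]. *)
    rewrite m_inv, Rmin_comm, Rmax_comm; split; reflexivity.
Qed.

Lemma upper_ends (n : node) : geometric n ->
  lo (upper n) = Rmin (mob n (p3 (ns n))) (mob n (p4 (ns n))) /\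
  hi (upper n) = Rmax (mob n (p3 (ns n))) (mob n (p4 (ns n))).
Proof.
  intros G; pose proof m_bounds; unfold lo, hi.
  destruct (ns n) as [| |a] eqn:E.
  - unfold upper; rewrite E; simpl; split; reflexivity.
  - unfold upper; rewrite E; simpl.
    replace (4 + 1 - m) with (5 - m) by lra; split; reflexivity.
  - assert (S : ns (upper n) = Full) by (unfold upper; now rewrite E).
    rewrite S; simpl; rewrite !(mob_upper n a) by (auto; lra).
    rewrite m_inv; split; reflexivity.
Qed.

Lemma node_split (n : node) : geometric n ->
  (split_into node lo hi gap n (lower n) (upper n) \/
   split_into node lo hi gap n (upper n) (lower n)) /\
  hi (lower n) - lo (lower n) =
    Rabs (ne n) * wid (nd n) (p1 (ns n)) (p2 (ns n)) /\
  hi (upper n) - lo (upper n) =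
    Rabs (ne n) * wid (nd n) (p3 (ns n)) (p4 (ns n)).
Proof.
  intros G; pose proof (breakpoints n G) as B; unfold split_into.
  destruct (lower_ends n G) as [-> ->], (upper_ends n G) as [-> ->].
  unfold lo, hi, gap.
  pose proof (mob_sub n (p1 (ns n)) (p2 (ns n))).
  pose proof (mob_sub n (p2 (ns n)) (p3 (ns n))).
  pose proof (mob_sub n (p3 (ns n)) (p4 (ns n))).
  pose proof (wid_pos (nd n) (p1 (ns n)) (p2 (ns n)) ltac:(lra) ltac:(lra)).
  pose proof (wid_pos (nd n) (p2 (ns n)) (p3 (ns n)) ltac:(lra) ltac:(lra)).
  pose proof (wid_pos (nd n) (p3 (ns n)) (p4 (ns n)) ltac:(lra) ltac:(lra)).
  (* For positive [ne n] the map is decreasing and the upper child lies on the left; for negative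
     [ne n] the lower child does. *)
  destruct (Rle_lt_dec 0 (ne n)) as [e|e].
  - rewrite Rabs_pos_eq by lra.
    assert (0 <= ne n * wid (nd n) (p1 (ns n)) (p2 (ns n))) by (apply Rmult_le_pos; lra).
    assert (0 <= ne n * wid (nd n) (p2 (ns n)) (p3 (ns n))) by (apply Rmult_le_pos; lra).
    assert (0 <= ne n * wid (nd n) (p3 (ns n)) (p4 (ns n))) by (apply Rmult_le_pos; lra).
    rewrite !Rmin_right, !Rmax_left by lra; lra.
  - rewrite Rabs_left by lra.
    assert (0 <= - ne n * wid (nd n) (p1 (ns n)) (p2 (ns n))) by (apply Rmult_le_pos; lra).
    assert (0 <= - ne n * wid (nd n) (p2 (ns n)) (p3 (ns n))) by (apply Rmult_le_pos; lra).
    assert (0 <= - ne n * wid (nd n) (p3 (ns n)) (p4 (ns n))) by (apply Rmult_le_pos; lra).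
    rewrite !Rmin_left, !Rmax_right by lra; lra.
Qed.

(** * Gaps do not grow along the tree *)

Lemma abs_div_sqr (e A : R) : 0 < A -> Rabs (e / (A * A)) = Rabs e / (A * A).
Proof.
  intros HA; unfold Rdiv; rewrite Rabs_mult, (Rabs_pos_eq (/ _)); [reflexivity|].
  apply Rlt_le, Rinv_0_lt_compat, Rmult_lt_0_compat; assumption.
Qed.

Lemma gap_lower_le (n : node) : geometric n -> gap (lower n) <= gap n.
Proof.
  intros G; pose proof (Rabs_pos (ne n)) as He.
  pose proof (block_range n) as Hb.
  pose proof G as (_ & Hd & _); pose proof m_bounds; pose proof M_bounds.
  unfold gap, lower; destruct (ns n) as [| |a]; simpl.
  - apply Rmult_le_compat_l; [assumption|]; apply wid_le; try lra; nra.
  - apply Rmult_le_compat_l; [assumption|]; apply wid_le; try lra; nra.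
  - specialize (Hb a G eq_refl).
    rewrite Rdiv_opp_l, Rabs_Ropp, abs_div_sqr by lra.
    unfold Rdiv; rewrite Rmult_assoc; apply Rmult_le_compat_l; [assumption|].
    set (A := IZR a + nd n).
    assert (HA : 8 / 5 <= A <= 37 / 8) by (unfold A; lra).
    (* The factor [/ (A * A)] clears the denominators brought in by the new ratio [/ A]. *)
    replace (/ (A * A) * wid (/ A) (3 - m) (3 + m))
      with (2 * m / (((3 - m) * A + 1) * ((3 + m) * A + 1)))
      by (unfold wid; field; repeat split; nra).
    rewrite wid_frac by lra.
    replace (IZR a + M + nd n) with (A + M) by (unfold A; ring).
    replace (IZR a + 1 - M + nd n) with (A + 1 - M) by (unfold A; ring).
    clearbody A; apply frac_le; [apply Rmult_lt_0_compat; nra .. |].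
    (* The two factors add up to [2 * A + 1], so their product is at most the square of
       [A + 1 / 2]. *)
    assert (2 * m * ((A + M) * (A + 1 - M)) <= 42 / 100 * (A * A + A + 1 / 4)) by
      (apply Rmult_le_compat; nra).
    assert (0 <= (1 - m * m) * (A * A)) by (apply Rmult_le_pos; nra).
    (* The product expands to [(9 - m * m) * (A * A) + 6 * A + 1], and [m * m <= 1]. *)
    assert (9 / 100 * (8 * (A * A) + 6 * A + 1) <=
      (IZR a + 1 - M - (IZR a + M)) * (((3 - m) * A + 1) * ((3 + m) * A + 1)))
      by (apply Rmult_le_compat; nra).
    nra.
Qed.

Lemma gap_upper_le (n : node) : geometric n -> gap (upper n) <= gap n.
Proof.
  intros G; pose proof (Rabs_pos (ne n)) as He.
  pose proof (block_range n) as Hb.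
  pose proof G as (_ & Hd & _); pose proof m_bounds; pose proof M_bounds.
  unfold gap, upper; destruct (ns n) as [| |a]; simpl.
  - apply Rmult_le_compat_l; [assumption|]; apply wid_le; try lra; nra.
  - apply Rmult_le_compat_l; [assumption|]; apply wid_le; try lra; nra.
  - specialize (Hb a G eq_refl).
    rewrite abs_div_sqr by lra.
    unfold Rdiv; rewrite Rmult_assoc; apply Rmult_le_compat_l; [assumption|].
    set (A := IZR a + 1 + nd n).
    assert (HA : 13 / 5 <= A <= 45 / 8) by (unfold A; lra).
    replace (/ (A * A) * wid (- / A) (3 - m) (3 + m))
      with (2 * m / (((3 - m) * A - 1) * ((3 + m) * A - 1)))
      by (unfold wid; field; repeat split; nra).
    rewrite wid_frac by lra.
    replace (IZR a + M + nd n) with (A - 1 + M) by (unfold A; ring).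
    replace (IZR a + 1 - M + nd n) with (A - M) by (unfold A; ring).
    clearbody A; apply frac_le; [apply Rmult_lt_0_compat; nra .. |].
    (* As for the lower child, with the square of [A - 1 / 2]. *)
    assert (2 * m * ((A - 1 + M) * (A - M)) <= 42 / 100 * (A * A - A + 1 / 4)) by
      (apply Rmult_le_compat; nra).
    assert (0 <= (1 - m * m) * (A * A)) by (apply Rmult_le_pos; nra).
    assert (9 / 100 * (8 * (A * A) - 6 * A + 1) <=
      (IZR a + 1 - M - (IZR a + M)) * (((3 - m) * A - 1) * ((3 + m) * A - 1)))
      by (apply Rmult_le_compat; nra).
    nra.
Qed.

(** * Gap and length in terms of the scale, and stability of the geometric bounds *)

Lemma gap_ge (n : node) : geometric n -> Rabs (ne n) / 400 <= gap n.
Proof.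
  intros G; pose proof (breakpoints n G); unfold gap, Rdiv.
  apply Rmult_le_compat_l; [apply Rabs_pos|].
  rewrite wid_frac by lra.
  rewrite <- Rdiv_1_l; apply frac_le; [lra | apply Rmult_lt_0_compat; lra |].
  (* The constant 1/400 is 9/100 divided by 36. *)
  assert ((p2 (ns n) + nd n) * (p3 (ns n) + nd n) <= 6 * 6)
    by (apply Rmult_le_compat; lra).
  lra.
Qed.

Lemma length_le (n : node) : geometric n -> hi n - lo n <= Rabs (ne n).
Proof.
  intros G; pose proof (breakpoints n G); rewrite length_eq by assumption.
  rewrite <- (Rmult_1_r (Rabs (ne n))) at 2.
  apply Rmult_le_compat_l; [apply Rabs_pos|].
  unfold wid.
  assert (0 < / (p4 (ns n) + nd n)) by (apply Rinv_0_lt_compat; lra).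
  assert (/ (p1 (ns n) + nd n) <= / 1) by (apply Rinv_le_contravar; lra).
  lra.
Qed.

(** One NICF step divides the scale by [A * A], which lies between 9/4 and 36. *)
Lemma scale_bounds (e A : R) (l : nat) : 3 / 2 <= A <= 6 ->
  / 36 ^ l <= Rabs e <= / 2 ^ l ->
  / 36 ^ S l <= Rabs (e / (A * A)) <= / 2 ^ S l.
Proof.
  intros HA [H1 H2]; rewrite abs_div_sqr by lra; simpl.
  rewrite !Rinv_mult.
  assert (/ 36 <= / (A * A)) by (apply Rinv_le_contravar; nra).
  assert (/ (A * A) <= / 2) by (apply Rinv_le_contravar; nra).
  assert (0 < / 36 ^ l) by (apply Rinv_0_lt_compat, pow_lt; lra).
  unfold Rdiv; rewrite (Rmult_comm (/ 36)), (Rmult_comm (/ 2)).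
  split; apply Rmult_le_compat; lra.
Qed.

Lemma geometric_lower (n : node) : geometric n -> geometric (lower n).
Proof.
  intros G; pose proof (block_range n) as Hb; pose proof G as (He & Hd & _ & Hs).
  unfold geometric, lower; destruct (ns n) as [| |a]; simpl.
  - repeat split; try lra; inversion H; lia.
  - repeat split; try lra; inversion H; lia.
  - specialize (Hb a G eq_refl).
    set (A := IZR a + nd n).
    (* The reciprocal of 8/5 is the upper bound 5/8 for [nd] again. *)
    assert (HA : 8 / 5 <= A <= 37 / 8) by (unfold A; lra).
    assert (/ A <= / (8 / 5)) by (apply Rinv_le_contravar; lra).
    assert (0 < / A) by (apply Rinv_0_lt_compat; lra).
    rewrite Rdiv_opp_l, Rabs_Ropp.
    split; [|split; [lra | split; [discriminate|]]].
    + apply Ropp_neq_0_compat, Rmult_integral_contrapositive_currified;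
        [assumption | apply Rinv_neq_0_compat; nra].
    + apply scale_bounds; lra.
Qed.

Lemma geometric_upper (n : node) : geometric n -> geometric (upper n).
Proof.
  intros G; pose proof (block_range n) as Hb; pose proof G as (He & Hd & _ & Hs).
  unfold geometric, upper; destruct (ns n) as [| |a]; simpl.
  - repeat split; try lra; discriminate.
  - repeat split; try lra; inversion H; lia.
  - specialize (Hb a G eq_refl).
    set (A := IZR a + 1 + nd n).
    (* The reciprocal of 13/5 is below 2/5, which gives the lower bound for [nd]. *)
    assert (HA : 13 / 5 <= A <= 45 / 8) by (unfold A; lra).
    assert (/ A <= / (13 / 5)) by (apply Rinv_le_contravar; lra).
    assert (0 < / A) by (apply Rinv_0_lt_compat; lra).
    split; [|split; [lra | split; [discriminate|]]].
    + apply Rmult_integral_contrapositive_currified;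
        [assumption | apply Rinv_neq_0_compat; nra].
    + apply scale_bounds; lra.
Qed.

(** * NICF steps along the tree *)

Lemma nearest_int_unique (x : R) (k : Z) :
  - (1 / 2) <= x - IZR k < 1 / 2 -> nearest_int x = k.
Proof.
  intros H; pose proof (nearest_int_spec x).
  assert (nearest_int x - k < 1)%Z by (apply lt_IZR; rewrite minus_IZR; lra).
  assert (-1 < nearest_int x - k)%Z by (apply lt_IZR; rewrite minus_IZR; lra).
  lia.
Qed.

(** Since [2 < Rabs z] is strict, [/ z] stays away from 1/2 and -1/2 and no tie occurs. *)
Lemma nicf_complete_step (x y z : R) (k : Z) (i : nat) :
  nicf_complete x i = Some y -> y = IZR k + / z -> 2 < Rabs z ->
  nicf_complete x (S i) = Some z /\ nearest_int y = k.
Proof.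
  intros Hx Hy Hz.
  assert (z0 : z <> 0) by (intros ->; rewrite Rabs_R0 in Hz; lra).
  assert (Habs : Rabs (/ z) < / 2).
  { rewrite Rabs_inv; apply Rinv_lt_contravar; lra. }
  apply Rabs_def2 in Habs.
  assert (E : nearest_int y = k) by (apply nearest_int_unique; lra).
  split; [|exact E].
  simpl; rewrite Hx, E.
  pose proof (Rinv_neq_0_compat z z0).
  destruct (Req_dec_T _ _) as [C|_]; [lra|].
  f_equal; replace (y - IZR k) with (/ z) by lra; field; assumption.
Qed.

(** Away from ties rounding is odd, so a step from [- y] yields [- k] and [- z]. *)
Lemma nicf_signed_step (x y z : R) (k : Z) (l : nat) :
  (Z.abs k <= 5)%Z -> y = IZR k + / z -> 2 < Rabs z ->
  nicf_complete x (S l) = Some y \/ nicf_complete x (S l) = Some (- y) ->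
  (forall i a, (1 <= i <= l)%nat ->
     nicf_quotient x i = Some a -> (Z.abs a <= 5)%Z) ->
  (nicf_complete x (S (S l)) = Some z \/ nicf_complete x (S (S l)) = Some (- z)) /\
  (forall i a, (1 <= i <= S l)%nat ->
     nicf_quotient x i = Some a -> (Z.abs a <= 5)%Z).
Proof.
  intros Hk Hy Hz Hx Hi.
  assert (exists k', (Z.abs k' <= 5)%Z /\ nicf_quotient x (S l) = Some k' /\
    (nicf_complete x (S (S l)) = Some z \/ nicf_complete x (S (S l)) = Some (- z)))
    as (k' & Hk' & Hq & Hc).
  { unfold nicf_quotient; destruct Hx as [Hx|Hx].
    - destruct (nicf_complete_step x y z k _ Hx Hy Hz) as [H1 H2].
      exists k; rewrite Hx; simpl option_map; rewrite H2; auto.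
    - destruct (nicf_complete_step x (- y) (- z) (- k) _ Hx) as [H1 H2].
      + rewrite Hy, opp_IZR, Rinv_opp; ring.
      + now rewrite Rabs_Ropp.
      + exists (- k)%Z; rewrite Hx; simpl option_map; rewrite H2.
        split; [lia | auto]. }
  split; [exact Hc|].
  intros i a Hil Ha; destruct (Nat.eq_dec i (S l)) as [->|N].
  - rewrite Hq in Ha; injection Ha as <-; exact Hk'.
  - apply (Hi i); [lia | exact Ha].
Qed.

Lemma inv_full_range (z : R) : 2 + m <= z <= 5 - m -> m <= / z <= M.
Proof.
  intros Hz; pose proof m_bounds.
  rewrite <- m_inv at 1; unfold M; split; apply Rinv_le_contravar; lra.
Qed.

Lemma valid_lower (n : node) : valid n -> valid (lower n).
Proof.
  intros [G H]; split; [now apply geometric_lower|].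
  intros z Hz; pose proof m_bounds; pose proof M_bounds.
  pose proof (block_range n) as Hb; pose proof (mob_lower n) as Hm.
  pose proof G as (_ & _ & Ha & _).
  unfold arithmetic, lower in *; destruct (ns n) as [| |a]; simpl in Hz, H.
  - apply H; lra.
  - apply H; lra.
  - specialize (Hb a G eq_refl); pose proof (inv_full_range z Hz).
    specialize (Ha a eq_refl).
    rewrite Hm with (a := a) by (auto; lra).
    destruct (H (IZR a + / z)) as [Hc Hq]; [lra|].
    apply (nicf_signed_step _ (IZR a + / z) z a); auto; [lia|].
    rewrite Rabs_pos_eq; lra.
Qed.

Lemma valid_upper (n : node) : valid n -> valid (upper n).
Proof.
  intros [G H]; split; [now apply geometric_upper|].
  intros z Hz; pose proof m_bounds; pose proof M_bounds.
  pose proof (block_range n) as Hb; pose proof (mob_upper n) as Hm.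
  pose proof G as (_ & _ & Ha & _).
  unfold arithmetic, upper in *; destruct (ns n) as [| |a]; simpl in Hz, H.
  - apply H; lra.
  - apply H; lra.
  - specialize (Hb a G eq_refl); pose proof (inv_full_range z Hz).
    specialize (Ha a eq_refl).
    rewrite Hm with (a := a) by (auto; lra).
    destruct (H (IZR a + 1 - / z)) as [Hc Hq]; [lra|].
    (* Here [y] is [(a + 1) + 1 / (- z)]: the quotient is [a + 1], at most 5, and the sign flips,
       which exchanges the two alternatives. *)
    cut ((nicf_complete (mob n (IZR a + 1 - / z)) (S (S (nl n))) = Some (- z) \/
          nicf_complete (mob n (IZR a + 1 - / z)) (S (S (nl n))) = Some (- - z)) /\
      (forall i b, (1 <= i <= S (nl n))%nat ->
        nicf_quotient (mob n (IZR a + 1 - / z)) i = Some b -> (Z.abs b <= 5)%Z)).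
    { rewrite Ropp_involutive; intros [[C|C] Q]; split; auto. }
    apply (nicf_signed_step _ (IZR a + 1 - / z) (- z) (a + 1)); auto; [lia| |].
    + rewrite plus_IZR, Rinv_opp; ring.
    + rewrite Rabs_Ropp, Rabs_pos_eq; lra.
Qed.

(** * Rank against gaps and lengths *)

Lemma rank_lower (n : node) : (rank n < rank (lower n))%nat.
Proof. unfold rank, lower; destruct (ns n); simpl; lia. Qed.

Lemma rank_upper (n : node) : (rank n < rank (upper n))%nat.
Proof. unfold rank, upper; destruct (ns n); simpl; lia. Qed.

Lemma node_gap_bounded_below (r : nat) : exists eps,
  0 < eps /\ forall n, valid n -> (rank n <= r)%nat -> eps <= gap n.
Proof.
  assert (0 < / 36 ^ r) by (apply Rinv_0_lt_compat, pow_lt; lra).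
  exists (/ 36 ^ r / 400); split; [lra|].
  intros n [G _] Hr; pose proof (gap_ge n G); destruct G as (_ & _ & _ & Hs).
  assert (nl n <= r)%nat by (unfold rank in Hr; lia).
  assert (/ 36 ^ r <= / 36 ^ nl n).
  { apply Rinv_le_contravar; [apply pow_lt; lra | apply Rle_pow; [lra | assumption]]. }
  lra.
Qed.

Lemma node_length_small (eps : R) : 0 < eps -> exists r : nat,
  forall n, valid n -> (r <= rank n)%nat -> hi n - lo n < eps.
Proof.
  intros He.
  destruct (pow_lt_1_zero (/ 2)) with (y := eps) as [k Hk];
    [rewrite Rabs_pos_eq; lra | exact He |].
  (* The shape adds at most 2 to the rank, so rank at least [3 * k] forces [k <= nl n]. *)
  exists (3 * k)%nat; intros n [G _] Hr.
  pose proof (length_le n G); destruct G as (_ & _ & _ & Hs).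
  assert (k <= nl n)%nat by (unfold rank in Hr; destruct (ns n); lia).
  specialize (Hk (nl n) ltac:(lia)).
  rewrite pow_inv, Rabs_pos_eq in Hk; [lra|].
  apply Rlt_le, Rinv_0_lt_compat, pow_lt; lra.
Qed.

(** * Limits of the tree have bounded quotients *)

Lemma mob_onto (n : node) (u : R) : geometric n -> lo n <= u <= hi n ->
  exists y, p1 (ns n) <= y <= p4 (ns n) /\ u = mob n y.
Proof.
  intros G Hu; pose proof (breakpoints n G) as B; pose proof G as (He & _).
  (* [t] is the value that [1 / (y + nd n)] must take. *)
  pose (t := (u - nc n) / ne n).
  assert (Ht : u = nc n + ne n * t) by (unfold t; field; assumption).
  assert (0 < / (p4 (ns n) + nd n)) by (apply Rinv_0_lt_compat; lra).
  assert (0 < / (p1 (ns n) + nd n)) by (apply Rinv_0_lt_compat; lra).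
  assert (L : / (p4 (ns n) + nd n) < / (p1 (ns n) + nd n))
    by (apply Rinv_lt_contravar; [apply Rmult_lt_0_compat|]; lra).
  assert (T : / (p4 (ns n) + nd n) <= t <= / (p1 (ns n) + nd n)).
  { unfold lo, hi, mob, Rdiv in Hu; rewrite Ht in Hu.
    destruct (Rtotal_order (ne n) 0) as [e|[e|e]]; [|contradiction|].
    - rewrite Rmin_left, Rmax_right in Hu by nra; nra.
    - rewrite Rmin_right, Rmax_left in Hu by nra; nra. }
  exists (/ t - nd n); split.
  - assert (/ t <= p4 (ns n) + nd n).
    { rewrite <- (Rinv_inv (p4 (ns n) + nd n)); apply Rinv_le_contravar; lra. }
    assert (p1 (ns n) + nd n <= / t).
    { rewrite <- (Rinv_inv (p1 (ns n) + nd n)); apply Rinv_le_contravar; lra. }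
    lra.
  - rewrite Ht; unfold mob; field; lra.
Qed.

Lemma nicf_complete_shift (x : R) (k : Z) (i : nat) :
  nicf_complete (IZR k + x) (S i) = nicf_complete x (S i).
Proof.
  assert (E : nearest_int (IZR k + x) = (k + nearest_int x)%Z).
  { apply nearest_int_unique; rewrite plus_IZR.
    pose proof (nearest_int_spec x); lra. }
  induction i as [|i IH].
  - simpl; rewrite E, plus_IZR.
    destruct (Req_dec_T _ _), (Req_dec_T _ _); try reflexivity; try lra.
    do 2 f_equal; ring.
  - change (nicf_complete (IZR k + x) (S (S i))) with
      (match nicf_complete (IZR k + x) (S i) with
       | Some y => if Req_dec_T y (IZR (nearest_int y)) then None
                   else Some (1 / (y - IZR (nearest_int y)))
       | None => None end).
    rewrite IH; reflexivity.
Qed.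

Lemma nicf_bounded_shift (N k : Z) (x : R) :
  nicf_quotients_bounded N x -> nicf_quotients_bounded N (IZR k + x).
Proof.
  intros H i a Hi; destruct i as [|i]; [lia|].
  unfold nicf_quotient; rewrite nicf_complete_shift; now apply H.
Qed.

Lemma tree_limit_bounded (u : R) :
  tree_limit node valid lo hi rank u -> nicf_quotients_bounded 5 u.
Proof.
  intros H i a Hi Hq.
  destruct (H (3 * i)%nat) as (n & [G A] & Hr & Hu).
  destruct (mob_onto n u G Hu) as (y & Hy & ->).
  apply (proj2 (A y Hy) i); [|exact Hq].
  unfold rank in Hr; destruct (ns n); lia.
Qed.

(** * The two roots, for [E] and [- E], and the covering of the line modulo 1 *)

Definition root (e : R) : node := Node 0 e 0 Full 0.

Lemma valid_root (e : R) : e = 1 \/ e = -1 -> valid (root e).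
Proof.
  intros He.
  assert (Ha : Rabs e = 1)
    by (destruct He as [->| ->]; [apply Rabs_R1 | rewrite Rabs_left; lra]).
  split.
  - unfold geometric; simpl; rewrite Ha.
    repeat split; try lra; discriminate.
  - intros y Hy; simpl in Hy; pose proof m_bounds; split; [|simpl; lia].
    assert (E : nicf_complete (mob (root e) y) 1 = Some (e * y)).
    { apply (nicf_complete_step _ (mob (root e) y) _ 0); [reflexivity | |].
      - unfold mob; simpl.
        destruct He as [->| ->]; field; lra.
      - rewrite Rabs_mult, Ha, Rabs_pos_eq; lra. }
    simpl nl; rewrite E; destruct He as [->| ->]; [left | right]; f_equal; ring.
Qed.

Lemma root_pos : lo (root 1) = m /\ hi (root 1) = M.
Proof.
  pose proof m_bounds; pose proof M_bounds; unfold lo, hi, mob; simpl.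
  rewrite !Rplus_0_r, !Rplus_0_l, !Rdiv_1_l, m_inv; fold M.
  rewrite Rmin_right, Rmax_left; lra.
Qed.

Lemma root_neg : lo (root (-1)) = - M /\ hi (root (-1)) = - m.
Proof.
  pose proof m_bounds; pose proof M_bounds; unfold lo, hi, mob; simpl.
  replace (0 + -1 / (2 + m + 0)) with (- / (2 + m)) by (field; lra).
  replace (0 + -1 / (5 - m + 0)) with (- / (5 - m)) by (field; lra).
  rewrite m_inv; fold M; rewrite Rmin_left, Rmax_right; lra.
Qed.

Lemma root_sum (e f s : R) : e = 1 \/ e = -1 -> f = 1 \/ f = -1 ->
  lo (root e) + lo (root f) <= s <= hi (root e) + hi (root f) ->
  exists u, nicf_quotients_bounded 5 u /\ nicf_quotients_bounded 5 (s - u).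
Proof.
  intros He Hf Hs.
  destruct (sum_of_tree_limits node valid lo hi gap lower upper rank) with
    (s := s) (n := root e) (k := root f) as (u & Hu & Hv).
  - exact valid_lower.
  - exact valid_upper.
  - intros n [G _]; apply (node_split n G).
  - intros n [G _]; pose proof (gap_ge n G); destruct G as (He' & _).
    pose proof (Rabs_pos_lt _ He'); lra.
  - intros n [G _]; destruct (node_split n G) as (_ & -> & _).
    apply Rmult_le_compat_l; [apply Rabs_pos | now apply wid_gap_lower].
  - intros n [G _]; destruct (node_split n G) as (_ & _ & ->).
    apply Rmult_le_compat_l; [apply Rabs_pos | now apply wid_gap_upper].
  - intros n [G _]; now apply gap_lower_le.
  - intros n [G _]; now apply gap_upper_le.
  - exact rank_lower.
  - exact rank_upper.
  - exact node_gap_bounded_below.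
  - exact node_length_small.
  (* Both root intervals have length [M - m], so this bound is the gap condition for every choice of
     signs. *)
  - assert (W : gap (root 1) <= M - m /\ gap (root (-1)) <= M - m).
    { assert (gap (root 1) <= M - m).
      { unfold gap; simpl; rewrite Rabs_R1, Rmult_1_l.
        pose proof m_bounds; pose proof M_bounds.
        rewrite wid_frac by lra.
        replace (M - m) with ((M - m) / 1) by field.
        apply frac_le; nra. }
      replace (gap (root (-1))) with (gap (root 1)); [lra|].
      unfold gap; simpl; rewrite Rabs_R1, (Rabs_left (-1)) by lra; lra. }
    destruct root_pos, root_neg.
    split; [now apply valid_root | split; [now apply valid_root|]]; simpl.
    split; [exact Hs|].
    destruct He as [->| ->], Hf as [->| ->]; lra.
  - exists u; split; now apply tree_limit_bounded.
Qed.

Theorem theorem1p2 :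
  forall x : R, exists u v : R,
    x = u + v /\ nicf_quotients_bounded 5 u /\ nicf_quotients_bounded 5 v.
Proof.
  intros x; pose proof m_bounds; pose proof M_bounds.
  destruct root_pos as [P1 P2], root_neg as [N1 N2].
  (* [x - IZR k] falls in the period of length 1 starting at [m - M], the left end of [E - E]. *)
  destruct (base_Int_part (x - (m - M))) as [I1 I2].
  set (k := Int_part (x - (m - M))) in *.
  assert (C : exists (j : Z) (u : R), nicf_quotients_bounded 5 u /\
                nicf_quotients_bounded 5 (x - IZR j - u)).
  (* The period is covered by [[m - M, M - m]], [[1 - 2 * M, 1 - 2 * m]] and [[2 * m, 2 * M]],
     coming from [E - E], [1 - E - E] and [E + E]. They leave no hole because [1 + m <= 3 * M] and
     [4 * m <= 1]. *)
  { destruct (Rle_dec (x - IZR k) (M - m)) as [C1|C1].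
    - exists k; apply (root_sum 1 (-1)); auto; lra.
    - destruct (Rle_dec (x - IZR k) (1 - 2 * m)) as [C2|C2].
      + exists (k + 1)%Z; apply (root_sum (-1) (-1)); auto; rewrite plus_IZR; lra.
      + exists k; apply (root_sum 1 1); auto; lra. }
  destruct C as (j & u & Hu & Hv).
  exists (IZR j + u), (x - IZR j - u); split; [ring|].
  split; [now apply nicf_bounded_shift | exact Hv].
Qed.
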